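(* Let $\mathbb{F}$ be an algebraically closed field of characteristic $2$. Every non-trivial $2$-dimensional right unital algebra over $\mathbb{F}$ is isomorphic to exactly one of the following pairwise non-isomorphic right unital algebras, given by their matrices of structure constants (MSC): \begin{itemize} \item $A_{1,2}(0,\alpha_2,0,\beta_1)$, where $\alpha_2,\beta_1\in\mathbb{F}$, $\alpha_2\neq 0$; \item $A_{3,2}(\alpha_1,0)$, where $\alpha_1\in\mathbb{F}$; \item $A_{6,2}(\alpha_1,0)$, where $\alpha_1\in\mathbb{F}$, $\alpha_1\neq 0$; \item $A_{7,2}(1)$; \item $A_{8,2}(\alpha_1)$, where $\alpha_1\in\mathbb{F}$, $\alpha_1\neq 0$; \item $A_{10,2}$. \end{itemize} Here $$A_{1,2}(\alpha_1,\alpha_2,\alpha_4,\beta_1)=\left(\begin{array}{cccc}\alpha_1 & \alpha_2 & \alpha_2+1 & \alpha_4\\ \beta_1 & -\alpha_1 & -\alpha_1+1 & -\alpha_2\end{array}\right),\qquad A_{3,2}(\alpha_1,\beta_2)=\left(\begin{array}{cccc}\alpha_1 & 1 & 1 & 0\\ 0 & \beta_2 & 1-\alpha_1 & 1\end{array}\right),$$ $$A_{6,2}(\alpha_1,\beta_1)=\left(\begin{array}{cccc}\alpha_1 & 0 & 0 & 1\\ \beta_1 & 1-\alpha_1 & -\alpha_1 & 0\end{array}\right),\qquad A_{7,2}(\alpha_1)=\left(\begin{array}{cccc}\alpha_1 & 1 & 1 & 0\\ 0 & 1-\alpha_1 & -\alpha_1 & -1\end{array}\right),$$ $$A_{8,2}(\alpha_1)=\left(\begin{array}{cccc}\alpha_1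 & 0 & 0 & 0\\ 0 & 1-\alpha_1 & -\alpha_1 & 0\end{array}\right),\qquad A_{10,2}=\left(\begin{array}{cccc}0 & 1 & 1 & 0\\ 0 & 0 & 0 & -1\end{array}\right).$$ (Different families, and different parameter values within a family, give non-isomorphic algebras.)
   Context: An algebra over a field $\mathbb{F}$ is a vector space $\mathbb{A}$ with a bilinear multiplication (not assumed associative, commutative or unital). It is non-trivial if its multiplication is not identically zero. For a $2$-dimensional algebra with basis $(e_1,e_2)$, its matrix of structure constants (MSC) is the $2\times 4$ matrix $A=\left(\begin{array}{cccc}\alpha_1&\alpha_2&\alpha_3&\alpha_4\\ \beta_1&\beta_2&\beta_3&\beta_4\end{array}\right)$ over $\mathbb{F}$ with $e_1e_1=\alpha_1e_1+\beta_1e_2$, $e_1e_2=\alpha_2e_1+\beta_2e_2$, $e_2e_1=\alpha_3e_1+\beta_3e_2$, $e_2e_2=\alpha_4e_1+\beta_4e_2$; equivalently, in coordinate columns, the product of $u$ and $v$ is $A(u\otimes v)$ with $\otimes$ the Kronecker product. An algebra is identified with its MSC. Two algebras with MSCs $A$ and $B$ are isomorphic iff $B=gA(g^{-1})^{\otimes 2}$ for some $g\in GL(2;\mathbb{F})$. An algebra $\mathbb{A}$ is right unital if there is an element $\mathbf{1}_R\in\mathbb{A}$ with $\mathbf{u}\cdot\mathbf{1}_R=\mathbf{u}$ for all $\mathbf{u}\in\mathbb{A}$. *)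

(* Defs.v *)
From HB Require Import structures.
From mathcomp Require Import all_boot all_order all_algebra.
From mathcomp Require Import mxtens.

Set Implicit Arguments.
Unset Strict Implicit.
Unset Printing Implicit Defensive.

Import GRing.Theory.
Local Open Scope ring_scope.

(* An algebra over F is a vector space V with a multiplication, given as
   mul : {bilinear V -> V -> V}. *)
Section Algebras.
Variable F : fieldType.

Definition nontrivial (V : vectType F) (mul : V -> V -> V) : Prop :=
  exists u v : V, mul u v != 0.

Definition right_unital (V : vectType F) (mul : V -> V -> V) : Prop :=
  exists r : V, forall u : V, mul u r = u.

Definition isomorphic (V W : vectType F)
    (mulV : V -> V -> V) (mulW : W -> W -> W) : Prop :=
  exists f : {linear V -> W},
    bijective f /\ forall u v : V, f (mulV u v) = mulW (f u) (f v).

End Algebras.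

(* The width 2 * 2 is that of a Kronecker product: columns 0, 1, 2, 3 hold the
   coordinates of e1e1, e1e2, e2e1, e2e2, see msc_mul_basis. *)
Notation "''MSC[' F ]" := 'M[F]_(2, 2 * 2)
  (at level 8, format "''MSC[' F ]") : type_scope.

Definition msc_mul (F : fieldType) (A : 'MSC[F]) (u v : 'cV[F]_2) : 'cV[F]_2 :=
  A *m (u *t v).

Lemma msc_mul_is_bilinear (F : fieldType) (A : 'MSC[F]) :
  bilinear_for *:%R *:%R (msc_mul A).
Proof.
split=> w a u v /=; rewrite /msc_mul scalemxAr -mulmxDr; congr (_ *m _).
  by apply/matrixP=> i j; rewrite !mxE mulrDl mulrA.
by apply/matrixP=> i j; rewrite !mxE mulrDr mulrCA.
Qed.

HB.instance Definition _ (F : fieldType) (A : 'MSC[F]) :=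
  bilinear_isBilinear.Build F 'cV[F]_2 'cV[F]_2 'cV[F]_2 *:%R *:%R
    (msc_mul A) (msc_mul_is_bilinear A).

Lemma tens_delta_mx (F : fieldType) (i j : 'I_2) :
  (delta_mx i 0 : 'cV[F]_2) *t (delta_mx j 0 : 'cV[F]_2)
    = delta_mx (mxtens_index (i, j)) 0.
Proof.
apply/matrixP=> k l; case: (mxtens_indexP k) => k1 k2.
rewrite !mxE mxtens_indexK !ord1 /= !eqxx !andbT -natrM mulnb.
by rewrite (inj_eq (can_inj (@mxtens_indexK 2 2))) xpair_eqE.
Qed.

Lemma msc_mul_basis (F : fieldType) (A : 'MSC[F]) (i j : 'I_2) :
  msc_mul A (delta_mx i 0) (delta_mx j 0) = col (mxtens_index (i, j)) A.
Proof. by rewrite /msc_mul tens_delta_mx colE. Qed.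

Lemma msc_mul_inj (F : fieldType) (A B : 'MSC[F]) :
  (forall u v, msc_mul A u v = msc_mul B u v) -> A = B.
Proof.
move=> eqAB; apply/matrixP=> i k; case: (mxtens_indexP k) => k1 k2.
have := eqAB (delta_mx k1 0) (delta_mx k2 0).
by rewrite !msc_mul_basis => /matrixP/(_ i 0); rewrite !mxE.
Qed.

(* For algebras given by matrices of structure constants, isomorphism is the
   matrix relation B = g A (g^-1)^{(x) 2}. *)
Lemma msc_isomorphicP (F : fieldType) (A B : 'MSC[F]) :
  isomorphic (msc_mul A) (msc_mul B) <->
  exists2 g : 'M[F]_2, g \in unitmx & B = g *m A *m (invmx g *t invmx g).
Proof.
split=> [[f [[h fK hK] fM]] | [g g_unit ->]]; last first.
  exists (mulmx g); split; first by exists (mulmx (invmx g));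
    [apply: mulKmx | apply: mulKVmx].
  move=> u v; rewrite /msc_mul -tensmx_mul -!mulmxA; do 2 congr (_ *m _).
  by rewrite !mulmxA tensmx_mul mulVmx // tensmx_mul !mul1mx.
pose g : 'M[F]_2 := (lin1_mx (trmx \o f \o trmx))^T.
have gE u : g *m u = f u.
  apply: trmx_inj; rewrite trmx_mul trmxK mul_rV_lin1 /=.
  by rewrite trmxK.
have g_unit : g \in unitmx.
  rewrite -unitmx_tr -row_free_unit; apply: inj_row_free => w wg0.
  apply: trmx_inj; apply: (can_inj fK).
  by rewrite -!gE trmx0 mulmx0 -[g]trmxK -trmx_mul wg0 trmx0.
exists g => //; apply: msc_mul_inj => u v.
rewrite -{1}(mulKVmx g_unit u) -{1}(mulKVmx g_unit v) !gE -fM -gE.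
by rewrite /msc_mul -tensmx_mul !mulmxA.
Qed.

Definition msc (F : fieldType) (a1 a2 a3 a4 b1 b2 b3 b4 : F) : 'MSC[F] :=
  \matrix_(i, j)
    (nth [::] [:: [:: a1; a2; a3; a4]; [:: b1; b2; b3; b4]] i)`_j.

Section Families.
Variable F : fieldType.

Definition A_1_2 (a1 a2 a4 b1 : F) : 'MSC[F] :=
  msc a1 a2     (a2 + 1)   a4
      b1 (- a1) (- a1 + 1) (- a2).

Definition A_3_2 (a1 b2 : F) : 'MSC[F] :=
  msc a1 1  1        0
      0  b2 (1 - a1) 1.

Definition A_6_2 (a1 b1 : F) : 'MSC[F] :=
  msc a1 0        0      1
      b1 (1 - a1) (- a1) 0.

Definition A_7_2 (a1 : F) : 'MSC[F] :=
  msc a1 1        1      0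
      0  (1 - a1) (- a1) (- 1).

Definition A_8_2 (a1 : F) : 'MSC[F] :=
  msc a1 0        0      0
      0  (1 - a1) (- a1) 0.

Definition A_10_2 : 'MSC[F] :=
  msc 0 1 1 0
      0 0 0 (- 1).

(* Labels, rather than matrices, index the list: uniqueness of a label states
   that different families, and different parameters within a family, give
   non-isomorphic algebras. *)
Inductive label : Type :=
  | L1 of F & F
  | L3 of F
  | L6 of F
  | L7
  | L8 of F
  | L10.

Definition admissible (l : label) : bool :=
  match l with
  | L1 a2 _ => a2 != 0
  | L6 a1 | L8 a1 => a1 != 0
  | L3 _ | L7 | L10 => true
  end.

Definition label_msc (l : label) : 'MSC[F] :=
  match l with
  | L1 a2 b1 => A_1_2 0 a2 0 b1
  | L3 a1 => A_3_2 a1 0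
  | L6 a1 => A_6_2 a1 0
  | L7 => A_7_2 1
  | L8 a1 => A_8_2 a1
  | L10 => A_10_2
  end.

End Families.

Arguments L7 {F}.
Arguments L10 {F}.

(* Main.v *)
(* In a basis (e1, e2) with e2 a right unit, the only unknown products are e1
   e1 and e2 e1. The traces of right and of left multiplications are two
   linear forms on the algebra that are preserved by isomorphisms; the right
   one vanishes at e2, where it is 2 = 0. If they are independent, the basis
   dual to them is canonical and gives A_{1,2}. Otherwise the right trace is
   nonzero (A_{3,2}), or it vanishes and the left trace does not (A_{6,2},
   A_{7,2}, A_{8,2}), or both vanish (A_{10,2}). In the middle case the
   families are told apart by the square of a vector w spanning the kernel of
   the left trace: w w is independent of w, a nonzero multiple of w, or zero. *)
From HB Require Import structures.
Require Import Defs.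
From mathcomp Require Import all_boot all_order all_algebra.
From mathcomp Require Import ring.
Import GRing.Theory.
Local Open Scope ring_scope.

Set Bullet Behavior "Strict Subproofs".

(** * Products in coordinates *)

Definition vec2 {F : fieldType} (x y : F) : 'cV[F]_2 := \col_i [:: x; y]`_i.

Lemma vec2_eta {F : fieldType} (u : 'cV[F]_2) : u = vec2 (u 0 0) (u 1 0).
Proof.
apply/colP=> i; rewrite mxE; case: i => [[|[|//]]] ilt /=;
  congr (u _ 0); exact: val_inj.
Qed.

Lemma vec2_inj {F : fieldType} (x y z w : F) :
  vec2 x y = vec2 z w -> x = z /\ y = w.
Proof.
by move=> /colP e; split; [have := e 0 | have := e 1]; rewrite !mxE.
Qed.

Lemma vec2D {F : fieldType} (x y z w : F) :
  vec2 x y + vec2 z w = vec2 (x + z) (y + w).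
Proof. by apply/colP=> -[[|[|//]] ilt]; rewrite !mxE. Qed.

Lemma vec2Z {F : fieldType} (a x y : F) : a *: vec2 x y = vec2 (a * x) (a * y).
Proof. by apply/colP=> -[[|[|//]] ilt]; rewrite !mxE. Qed.

Definition bilin {F : fieldType} (a1 a2 a3 a4 x y z w : F) : F :=
  a1 * (x * z) + a2 * (x * w) + a3 * (y * z) + a4 * (y * w).

Lemma msc_mul_vec2 {F : fieldType} (a1 a2 a3 a4 b1 b2 b3 b4 x y z w : F) :
  msc_mul (msc a1 a2 a3 a4 b1 b2 b3 b4) (vec2 x y) (vec2 z w)
  = vec2 (bilin a1 a2 a3 a4 x y z w) (bilin b1 b2 b3 b4 x y z w).
Proof.
apply/colP=> -[[|[|//]] ilt]; rewrite !mxE;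
  (* The sum has [2 * 2] terms; the explicit [3] lets this bound be matched with a successor. *)
  rewrite !(@big_ord_recl _ _ _ 3) !big_ord_recl;
  rewrite big_ord0 !mxE /= /bilin; ring.
Qed.

(** * Isomorphisms and changes of basis *)

Lemma isomorphic_trans {F : fieldType} {U V W : vectType F} {mU mV mW} :
  @isomorphic F U V mU mV -> @isomorphic F V W mV mW -> isomorphic mU mW.
Proof.
move=> [f [bf fM]] [g [bg gM]]; exists (g \o f).
by split=> [|u v /=]; [exact: bij_comp | rewrite fM gM].
Qed.

Lemma isomorphic_sym {F : fieldType} {V W : vectType F} {mV mW} :
  @isomorphic F V W mV mW -> isomorphic mW mV.
Proof.
move=> [f [[h fK hK] fM]].
pose hL := GRing.isLinear.Build _ _ _ _ h (GRing.can2_linear fK hK).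
pose h' : {linear W -> V} := HB.pack h hL.
exists h'; split=> [|u v /=]; first by exists f.
by apply: (can_inj fK); rewrite fM !hK.
Qed.

Lemma isomorphic_of_basis {F : fieldType} {V : vectType F}
    (mul : {bilinear V -> V -> V}) (e1 e2 : V)
    {a1 a2 a3 a4 b1 b2 b3 b4 : F} :
  basis_of {:V} [:: e1; e2] ->
  mul e1 e1 = a1 *: e1 + b1 *: e2 -> mul e1 e2 = a2 *: e1 + b2 *: e2 ->
  mul e2 e1 = a3 *: e1 + b3 *: e2 -> mul e2 e2 = a4 *: e1 + b4 *: e2 ->
  isomorphic (msc_mul (msc a1 a2 a3 a4 b1 b2 b3 b4)) mul.
Proof.
move=> bas m11 m12 m21 m22.
pose f (u : 'cV[F]_2) : V := u 0 0 *: e1 + u 1 0 *: e2.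
have fL : linear f.
  by move=> a u v; rewrite /f !mxE !scalerDl scalerDr !scalerA addrACA.
pose fl := GRing.isLinear.Build _ _ _ _ f fL.
pose f' : {linear 'cV[F]_2 -> V} := HB.pack f fl.
pose X := [tuple e1; e2].
have frX : free X := basis_free bas.
have E1 i : coord X i e1 = (0 == i)%:R := coord_free 0 i frX.
have E2 i : coord X i e2 = (1 == i)%:R := coord_free 1 i frX.
exists f'; split=> [|u v].
  exists (fun v => vec2 (coord X 0 v) (coord X 1 v)) => [u|v] /=.
    rewrite [RHS]vec2_eta /f !linearD !linearZ /= !E1 !E2 /=.
    by congr vec2; ring.
  rewrite [RHS](@coord_basis _ _ _ _ X _ bas (memvf v)) /f !mxE /=.
  rewrite !big_ord_recl big_ord0 addr0 /=.
  by have -> : lift ord0 ord0 = 1 :> 'I_2 by exact: val_inj.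
have combZ c a b : c *: (a *: e1 + b *: e2) = (c * a) *: e1 + (c * b) *: e2.
  by rewrite scalerDr !scalerA.
have combD a b c d : (a *: e1 + b *: e2) + (c *: e1 + d *: e2)
    = (a + c) *: e1 + (b + d) *: e2.
  by rewrite addrACA -!scalerDl.
rewrite (vec2_eta u) (vec2_eta v) msc_mul_vec2 /= /f !mxE /=.
rewrite !linearDl !linearDr /= !linearZl_LR !linearZr_LR /= m11 m12 m21 m22.
rewrite !(combZ, combD) /bilin; congr (_ *: _ + _ *: _); ring.
Qed.

(** A right unit of a nontrivial algebra is nonzero, so it can be taken as the second vector of a
    basis. *)
Lemma right_unital_msc {F : fieldType} (V : vectType F)
    (mul : {bilinear V -> V -> V}) :
  \dim {:V} = 2%N -> nontrivial mul -> right_unital mul ->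
  exists a b c d : F, isomorphic (msc_mul (msc a 1 c 0 b 0 d 1)) mul.
Proof.
move=> dimV [u [v uv_neq0]] [e e_unit].
have e_neq0 : e != 0.
  by apply: contra_neq uv_neq0 => e0; rewrite -[LHS]e_unit e0 linear0r.
have /subvPn[w _ w_notin] : ~~ ({:V} <= <[e]>)%VS.
  by apply/negP=> /dimvS; rewrite dimV dim_vline e_neq0.
have bas : basis_of {:V} [:: w; e].
  by rewrite basisEfree subvf dimV free_cons seq1_free span_seq1 w_notin e_neq0.
have coords x : exists a b : F, x = a *: w + b *: e.
  pose X := [tuple w; e].
  exists (coord X 0 x), (coord X 1 x).
  rewrite [LHS](@coord_basis _ _ _ _ X _ bas (memvf x)).
  rewrite !big_ord_recl big_ord0 addr0 /=.
  by have -> : lift ord0 ord0 = 1 :> 'I_2 by exact: val_inj.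
have [a [b ww]] := coords (mul w w); have [c [d ew]] := coords (mul e w).
exists a, b, c, d; apply: (isomorphic_of_basis mul w e) => //.
  by rewrite e_unit scale1r scale0r addr0.
by rewrite e_unit scale1r scale0r add0r.
Qed.

Lemma basis_of_vec2 {F : fieldType} (p q r s : F) :
  p * s - q * r != 0 -> basis_of {:'cV[F]_2} [:: vec2 p q; vec2 r s].
Proof.
move=> det_neq0; rewrite basisEfree subvf dimvf /dim /= !andbT.
rewrite free_cons seq1_free span_seq1; apply/andP; split.
  apply: contra_neqN det_neq0 => /vlineP[k].
  by rewrite vec2Z => /vec2_inj[-> ->]; ring.
apply: contra_neq det_neq0 => /colP vrs0.
by have := vrs0 0; have := vrs0 1; rewrite !mxE /= => -> ->; ring.
Qed.

(** The vectors [(p, q)] and [(r, s)] are the images of [e1] and [e2]. *)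
Lemma isomorphic_msc {F : fieldType} {a1 a2 a3 a4 b1 b2 b3 b4 : F}
    {c1 c2 c3 c4 d1 d2 d3 d4 : F} (p q r s : F) :
  p * s - q * r != 0 ->
  bilin c1 c2 c3 c4 p q p q = a1 * p + b1 * r ->
  bilin d1 d2 d3 d4 p q p q = a1 * q + b1 * s ->
  bilin c1 c2 c3 c4 p q r s = a2 * p + b2 * r ->
  bilin d1 d2 d3 d4 p q r s = a2 * q + b2 * s ->
  bilin c1 c2 c3 c4 r s p q = a3 * p + b3 * r ->
  bilin d1 d2 d3 d4 r s p q = a3 * q + b3 * s ->
  bilin c1 c2 c3 c4 r s r s = a4 * p + b4 * r ->
  bilin d1 d2 d3 d4 r s r s = a4 * q + b4 * s ->
  isomorphic (msc_mul (msc a1 a2 a3 a4 b1 b2 b3 b4))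
             (msc_mul (msc c1 c2 c3 c4 d1 d2 d3 d4)).
Proof.
move=> /basis_of_vec2 bas *.
pose B : {bilinear 'cV[F]_2 -> 'cV[F]_2 -> 'cV[F]_2} :=
  msc_mul (msc c1 c2 c3 c4 d1 d2 d3 d4).
apply: (isomorphic_of_basis B _ _ bas) => /=.
all: by rewrite msc_mul_vec2 !vec2Z vec2D; congr vec2.
Qed.

Lemma isomorphic_msc_inv {F : fieldType} {a1 a2 a3 a4 b1 b2 b3 b4 : F}
    {c1 c2 c3 c4 d1 d2 d3 d4 : F} :
  isomorphic (msc_mul (msc a1 a2 a3 a4 b1 b2 b3 b4))
             (msc_mul (msc c1 c2 c3 c4 d1 d2 d3 d4)) ->
  exists p q r s : F, p * s - q * r != 0 /\
  [/\ [/\ bilin c1 c2 c3 c4 p q p q = a1 * p + b1 * r &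
          bilin d1 d2 d3 d4 p q p q = a1 * q + b1 * s],
      [/\ bilin c1 c2 c3 c4 p q r s = a2 * p + b2 * r &
          bilin d1 d2 d3 d4 p q r s = a2 * q + b2 * s],
      [/\ bilin c1 c2 c3 c4 r s p q = a3 * p + b3 * r &
          bilin d1 d2 d3 d4 r s p q = a3 * q + b3 * s] &
      [/\ bilin c1 c2 c3 c4 r s r s = a4 * p + b4 * r &
          bilin d1 d2 d3 d4 r s r s = a4 * q + b4 * s]].
Proof.
move=> [f [[h fK _] fM]].
have := vec2_eta (f (vec2 1 0)); have := vec2_eta (f (vec2 0 1)).
move: (f (vec2 0 1) 0 0) (f (vec2 0 1) 1 0) => r s f01.
move: (f (vec2 1 0) 0 0) (f (vec2 1 0) 1 0) => p q f10.
have fE x y : f (vec2 x y) = vec2 (x * p + y * r) (x * q + y * s).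
  have -> : vec2 x y = x *: vec2 1 0 + y *: vec2 0 1.
    by rewrite !vec2Z vec2D; congr vec2; ring.
  by rewrite linearD !linearZ f10 f01 /= !vec2Z vec2D.
have f_inj x y : x * p + y * r = 0 -> x * q + y * s = 0 -> x = 0 /\ y = 0.
  move=> e1 e2; apply/vec2_inj/(can_inj fK); rewrite !fE e1 e2.
  by congr vec2; ring.
exists p, q, r, s; split.
  (* If the determinant vanished, [(- s, q)] and [(- r, p)] would be mapped to zero, hence
     [p = q = 0], and [e1] would be too. *)
  apply/eqP=> /subr0_eq det0.
  have [_ q0] : - s = 0 /\ q = 0 by apply: f_inj; ring: det0.
  have [_ p0] : - r = 0 /\ p = 0 by apply: f_inj; ring: det0.
  have [/eqP] : 1 = 0 :> F /\ 0 = 0 :> F; last by rewrite oner_eq0.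
  by apply: f_inj; ring: p0 q0.
have M x y z w := fM (vec2 x y) (vec2 z w).
split; [have := M 1 0 1 0 | have := M 1 0 0 1
       | have := M 0 1 1 0 | have := M 0 1 0 1].
all: rewrite msc_mul_vec2 !fE msc_mul_vec2 /bilin.
all: by rewrite !(mul0r, mul1r, mulr0, mulr1, addr0, add0r) => /vec2_inj[-> ->].
Qed.

(* Traces of right and left multiplications commute with isomorphisms: for a
   multiplication operator [M] and [g] the matrix of the isomorphism,
   [g *m M = M' *m g]; the linear combinations in the proof compute
   [\tr (g *m M *m \adj g)] in two ways. *)
Lemma isomorphic_msc_traces {F : fieldType} {a1 a2 a3 a4 b1 b2 b3 b4 : F}
    {c1 c2 c3 c4 d1 d2 d3 d4 : F} :
  isomorphic (msc_mul (msc a1 a2 a3 a4 b1 b2 b3 b4))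
             (msc_mul (msc c1 c2 c3 c4 d1 d2 d3 d4)) ->
  exists p q r s : F, [/\ p * s - q * r != 0,
    a1 + b3 = (c1 + d3) * p + (c2 + d4) * q
    /\ a2 + b4 = (c1 + d3) * r + (c2 + d4) * s,
    a1 + b2 = (c1 + d2) * p + (c3 + d4) * q
    /\ a3 + b4 = (c1 + d2) * r + (c3 + d4) * s,
    bilin c1 c2 c3 c4 p q p q = a1 * p + b1 * r /\
    bilin d1 d2 d3 d4 p q p q = a1 * q + b1 * s &
    bilin c1 c2 c3 c4 r s r s = a4 * p + b4 * r /\
    bilin d1 d2 d3 d4 r s r s = a4 * q + b4 * s].
Proof.
move=> /isomorphic_msc_inv[p [q [r [s [det_neq0]]]]].
case=> -[m11 n11] [m12 n12] [m21 n21] [m22 n22].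
have lincomb (x1 x2 x3 x4 y1 y2 y3 y4 u v : F) :
    x1 = y1 -> x2 = y2 -> x3 = y3 -> x4 = y4 ->
    (p * s - q * r) * (v - u)
      = s * (x1 - y1) - r * (x2 - y2) - q * (x3 - y3) + p * (x4 - y4) ->
  u = v.
  move=> -> -> -> ->; rewrite !subrr !mulr0 !subr0 addr0 => /eqP.
  by rewrite mulf_eq0 (negbTE det_neq0) subr_eq0 => /eqP.
exists p, q, r, s; split=> //; split.
- by apply: lincomb m11 n11 m21 n21 _; rewrite /bilin; ring.
- by apply: lincomb m12 n12 m22 n22 _; rewrite /bilin; ring.
- by apply: lincomb m11 n11 m12 n12 _; rewrite /bilin; ring.
- by apply: lincomb m21 n21 m22 n22 _; rewrite /bilin; ring.
Qed.

(** Provides square roots ([a = 0]) and solutions of Artin-Schreier equations ([a = 1]). *)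
Lemma quadratic_root {F : closedFieldType} (a b : F) :
  exists x, x * x = a * x + b.
Proof.
have [x xE] := @GRing.solve_monicpoly F 2 (fun i => [:: b; a]`_i) isT.
exists x; rewrite -expr2 xE !big_ord_recl big_ord0 /= expr0 expr1.
by rewrite mulr1 addr0 addrC.
Qed.

(** * Separation of the families and reduction to them *)

Section Classification.

Variables (F : closedFieldType) (charF2 : 2%N \in [pchar F]).

(* [ring: two0] clears even coefficients but leaves the sign of odd ones, hence
   the removal of opposites before its calls; it also uses its hypotheses in
   the given order. *)
Let two0 : 1 + 1 = 0 :> F := addrr_pchar2 charF2 1.

Ltac simp_hyps := repeat (subst; match goal with H : _ |- _ =>
  rewrite !(mul0r, mul1r, mulr0, mulr1, addr0, add0r) in H end).

Lemma label_inj (l l' : label F) : admissible l -> admissible l' ->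
  isomorphic (msc_mul (label_msc l)) (msc_mul (label_msc l')) -> l = l'.
Proof.
have addKr2 x y : x + (y + x) = y :> F.
  by rewrite addrCA addrr_pchar2 // addr0.
have sqr_eq0 x : x * x = 0 -> x = 0 :> F.
  by move/eqP; rewrite mulf_eq0 orbb => /eqP.
have oner_neq0 : (1 : F) <> 0 by apply/eqP/oner_neq0.
case: l => [a b|a|a||a|]; case: l' => [a' b'|a'|a'||a'|] _ _.
all: rewrite /= => /isomorphic_msc_traces[p [q [r [s]]]].
all: rewrite ?(oppr_pchar2 charF2) ?[_ + 1]addrC -?addrA.
all: rewrite ?(addKr2, addr0, add0r, addrr_pchar2 charF2) /bilin.
all: rewrite !(mul0r, mul1r, mulr0, mulr1, addr0, add0r).
all: case=> /eqP det_neq0 [e1 e2] [e3 e4] [e5 e6] [e7 e8]; subst.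
all: simp_hyps; rewrite ?(mul0r, mul1r, mulr0, mulr1, addr0, add0r).
all: try by [|case: oner_neq0|case: det_neq0].
(* Two families among [L6], [L7], [L8] remain: comparing squares of kernel vectors of the left trace
   gives [s * s = 0], while [r = 0]. *)
all: try by case: det_neq0; apply: sqr_eq0.
Qed.

(** The right unit is a multiple of [e1] for [L6] and [L8], and of [e2] otherwise. *)
Lemma label_right_unital (l : label F) :
  admissible l -> right_unital (msc_mul (label_msc l)).
Proof.
have unit_vec2 z w (a1 a2 a3 a4 b1 b2 b3 b4 : F) :
    a1 * z + a2 * w = 1 -> a3 * z + a4 * w = 0 ->
    b1 * z + b2 * w = 0 -> b3 * z + b4 * w = 1 ->
    right_unital (msc_mul (msc a1 a2 a3 a4 b1 b2 b3 b4)).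
  move=> e1 e2 e3 e4; exists (vec2 z w) => u.
  rewrite (vec2_eta u) msc_mul_vec2; move: (u 0 0) (u 1 0) => x y.
  congr vec2; rewrite /bilin.
    by transitivity (x * (a1 * z + a2 * w) + y * (a3 * z + a4 * w));
      [ring | rewrite e1 e2; ring].
  by transitivity (x * (b1 * z + b2 * w) + y * (b3 * z + b4 * w));
    [ring | rewrite e3 e4; ring].
case: l => [a b /mulfV|a _|a /mulfV|_|a /mulfV|_].
- by move: a^-1 => v aV; apply: (unit_vec2 0 v);
    rewrite ?(oppr_pchar2 charF2); ring: two0 aV.
- by apply: (unit_vec2 0 1); rewrite ?(oppr_pchar2 charF2); ring: two0.
- by move: a^-1 => v aV; apply: (unit_vec2 v 0);
    rewrite ?(oppr_pchar2 charF2); ring: two0 aV.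
- by apply: (unit_vec2 0 1); rewrite ?(oppr_pchar2 charF2); ring: two0.
- by move: a^-1 => v aV; apply: (unit_vec2 v 0);
    rewrite ?(oppr_pchar2 charF2); ring: two0 aV.
- by apply: (unit_vec2 0 1); rewrite ?(oppr_pchar2 charF2); ring: two0.
Qed.

(* The two traces are the row vectors [(a + d, 0)] and [(a, c + 1)]; the cases
   below are [c + 1 = 0] or not, and [a + d = 0] or not. When both are nonzero
   the new basis is the one dual to the traces. *)
Lemma right_unital_label (a b c d : F) : exists2 l : label F, admissible l &
  isomorphic (msc_mul (label_msc l)) (msc_mul (msc a 1 c 0 b 0 d 1)).
Proof.
(* In characteristic 2, [k] and [m] are the trace entries [a + d] and [c + 1]. *)
have [k ->] : exists k, d = k + a by exists (d - a); ring.
have [m ->] : exists m, c = m + 1 by exists (c - 1); ring.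
have [->|m_neq0] := eqVneq m 0; have [->|k_neq0] := eqVneq k 0.
- have [->|a_neq0] := eqVneq a 0.
  (* While [m = 0], the right unit stays [e2]. The other vector is scaled so that a nonzero trace
     takes the value 1 on it, and [q] times the unit is added so that its square is a multiple of
     itself. *)
  + have [q qq] := quadratic_root 0 b.
    exists L10 => //; apply: (isomorphic_msc 1 q 0 1).
      by rewrite mulr0 subr0 mulr1 oner_neq0.
    all: by rewrite /bilin ?(oppr_pchar2 charF2); ring: two0 qq.
  + have [q qq] := quadratic_root 0 (a^-1 * a^-1 * b).
    exists L7 => //.
    apply: (isomorphic_msc a^-1 q 0 1).
      by rewrite mulr0 subr0 mulr1 invr_neq0.
    all: move/mulfV: a_neq0 qq; move: a^-1 => u au qq.
    all: by rewrite /bilin ?(oppr_pchar2 charF2); ring: two0 au qq.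
- have [q qq] := quadratic_root 1 (k^-1 * k^-1 * b).
  exists (L3 (a * k^-1)) => //.
  apply: (isomorphic_msc k^-1 q 0 1).
    by rewrite mulr0 subr0 mulr1 invr_neq0.
  all: move/mulfV: k_neq0 qq; move: k^-1 => u kV qq.
  all: by rewrite /bilin ?(oppr_pchar2 charF2); ring: two0 kV qq.
- have mV := mulfV m_neq0; have mi_neq0 := invr_neq0 m_neq0.
  move: m^-1 => v in mV mi_neq0 *.
  (* The vector [(1, a * v)] spans the kernel of the left trace; its square is [B] times the right
     unit. *)
  pose B := b + a * a * v + a * a * v * v.
  have bE : b = B + a * a * v + a * a * v * v by rewrite /B; ring: two0.
  move: B bE => B ->.
  have [->|B_neq0] := eqVneq B 0.
  + exists (L8 v) => //.
    apply: (isomorphic_msc 0 v 1 (a * v)).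
      by rewrite mul0r sub0r mulr1 oppr_eq0.
    all: by rewrite /bilin ?(oppr_pchar2 charF2); ring: two0 mV.
  (* Scaling the kernel vector by [t] makes its square the new [e1], which is [v] times the right
     unit. *)
  + have [t tt] := quadratic_root 0 (v * B^-1).
    have t_neq0 : t != 0.
      apply: contraNneq (mulf_neq0 mi_neq0 (invr_neq0 B_neq0)) => t0.
      by move: tt; rewrite t0 !mul0r add0r => <-.
    exists (L6 v) => //.
    apply: (isomorphic_msc 0 v t (t * a * v)).
      by rewrite mul0r sub0r oppr_eq0 mulf_neq0.
    all: move/mulfV: B_neq0 tt; move: B^-1 => w BV tt.
    all: by rewrite /bilin ?(oppr_pchar2 charF2); ring: two0 mV BV tt.
- have mi_neq0 := invr_neq0 m_neq0; have ki_neq0 := invr_neq0 k_neq0.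
  move/mulfV: m_neq0 => mV; move/mulfV: k_neq0 => kV.
  move: m^-1 k^-1 => v u in mV kV mi_neq0 ki_neq0 *.
  (* In the dual basis [e2] is [v] times the right unit, so [e1 e2 = v e1]; the second parameter is
     the coefficient of [e2] in [e1 e1]. *)
  exists (L1 v (m * u * u * (b + (k + a) * a * v + a * a * v * v))) => //.
  apply: (isomorphic_msc u (a * u * v) 0 v).
    by rewrite mulr0 subr0 mulf_neq0.
  all: by rewrite /bilin ?(oppr_pchar2 charF2); ring: two0 mV kV.
Qed.

End Classification.

Theorem theorem4p2 (F : closedFieldType) (charF2 : 2%N \in [pchar F]) :
  (forall (V : vectType F) (mul : {bilinear V -> V -> V}),
      \dim {:V} = 2%N -> nontrivial mul -> right_unital mul ->
      exists! l : label F,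
        admissible l /\ isomorphic mul (msc_mul (label_msc l)))
  /\ (forall l : label F, admissible l -> right_unital (msc_mul (label_msc l)))
  /\ (forall l l' : label F, admissible l -> admissible l' ->
      isomorphic (msc_mul (label_msc l)) (msc_mul (label_msc l')) -> l = l').
Proof.
split; last by split; [exact: label_right_unital | exact: label_inj].
move=> V mul dimV nt ru.
have [a [b [c [d isoV]]]] := right_unital_msc V mul dimV nt ru.
have [l adm isol] := right_unital_label F charF2 a b c d.
have isoVl := isomorphic_sym (isomorphic_trans isol isoV).
exists l; split=> [//|l' [adm' isoVl']].
apply: (label_inj F charF2) => //.
exact: isomorphic_trans (isomorphic_sym isoVl) isoVl'.
Qed.
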